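(* Let $D$ be the formal derivative with respect to the context-free grammar $G\colon x\to xy,\ y\to xz,\ z\to zw,\ w\to xz$. For $n\ge 1$ let $$Q_n(x,y,z,w)=\sum_{i,j}Q_n(i,j)\,x^i y^j z^{i} w^{n+1-2i-j},$$ where $Q_n(i,j)$ is the number of permutations of $[n]$ with $i$ peaks and $j$ double descents. Then for all $n\ge 1$, $$D^n(y)=Q_n(x,y,z,w).$$
   Context: Let $x,y,z,w$ be commuting variables. The formal derivative $D$ with respect to $G$ is the linear operator on Laurent polynomials in $x,y,z,w$ satisfying $D(uv)=uD(v)+vD(u)$, $D(c)=0$ for constants $c$, and $D(x)=xy$, $D(y)=xz$, $D(z)=zw$, $D(w)=xz$. For a permutation $\pi=\pi_1\cdots\pi_n$ of $[n]$, set $\pi_0=\pi_{n+1}=0$. For $1\le i\le n$, index $i$ is a peak if $\pi_{i-1}<\pi_i>\pi_{i+1}$, and a double descent if $\pi_{i-1}>\pi_i>\pi_{i+1}$. *)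

(* Defs.v *)
From HB Require Import structures.
From mathcomp Require Import all_boot all_order all_algebra all_fingroup.
From mathcomp Require Import finmap.
From mathcomp.multinomials Require Import monalg.

Set Implicit Arguments.
Unset Strict Implicit.
Unset Printing Implicit Defensive.

Import Order.TTheory GRing.Theory Num.Theory.

Local Open Scope fset_scope.
Local Open Scope ring_scope.

(* [monalg] makes {malg R[K]} a ring only when K has no invertible monomial
   other than 1, so the ring structure on Laurent polynomials is built here, on
   its own name, as the group algebra of the additive group of exponents. *)
Definition exponent (n : nat) := {ffun 'I_n -> int}.
HB.instance Definition _ n := GRing.Zmodule.on (exponent n).

Definition laurent (R : comNzRingType) (n : nat) := {malg R[exponent n]}.

(* Locked, like [lmonom] below, so that unification never unfolds the sums. *)
HB.lock Definition lmul (R : comNzRingType) (n : nat) (g1 g2 : laurent R n) :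
    laurent R n :=
  \sum_(k1 <- msupp g1) \sum_(k2 <- msupp g2)
    mkmalgU (k1 + k2)%R (mcoeff k1 g1 * mcoeff k2 g2).

Section LaurentRing.
Context (R : comNzRingType) (n : nat).
Local Notation K := (exponent n).
Local Notation L := (laurent R n).
Implicit Types (g : L) (k : K).

HB.instance Definition _ := GRing.Lmodule.on L.

Local Notation U c k := (mkmalgU (k : K) (c : R) : L).

Definition lone : L := U 1 0.

Local Notation lmul := (@lmul R n).

Lemma lmulw (d1 d2 : {fset K}) g1 g2 :
  msupp g1 `<=` d1 -> msupp g2 `<=` d2 ->
  lmul g1 g2 = \sum_(k1 <- d1) \sum_(k2 <- d2)
                 U (mcoeff k1 g1 * mcoeff k2 g2) (k1 + k2).
Proof.
move=> le_d1 le_d2; rewrite !lmul.unlock (big_fset_incl _ le_d1) /=.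
  apply/eq_bigr=> k1 _; apply/big_fset_incl => // k _ /mcoeff_outdom ->.
  by rewrite mulr0 monalgU0.
move=> k _ /mcoeff_outdom g1k.
by rewrite big1 => // k' _; rewrite g1k mul0r monalgU0.
Qed.

Lemma lmulC : commutative lmul.
Proof.
move=> g1 g2; rewrite !lmul.unlock exchange_big /=; apply: eq_bigr => k1 _.
by apply: eq_bigr => k2 _; rewrite mulrC addrC.
Qed.

Lemma lmul0 : left_zero 0 lmul.
Proof. by move=> g; rewrite !lmul.unlock msupp0 big_seq_fset0. Qed.

Lemma lmulr0 : right_zero 0 lmul.
Proof. by move=> g; rewrite lmulC lmul0. Qed.

Lemma lmulUU c1 c2 k1 k2 : lmul (U c1 k1) (U c2 k2) = U (c1 * c2) (k1 + k2).
Proof. by rewrite (lmulw msuppU_le msuppU_le) !big_seq_fset1 !mcoeffUU. Qed.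

Lemma lmulU c k g :
  lmul (U c k) g = \sum_(k' <- msupp g) U (c * mcoeff k' g) (k + k').
Proof.
rewrite (lmulw msuppU_le (fsubset_refl _)) big_seq_fset1.
by apply/eq_bigr => k' _; rewrite mcoeffUU.
Qed.

Lemma lmul1 : left_id lone lmul.
Proof.
move=> g; rewrite lmulU [RHS]monalgE.
by apply/eq_bigr=> k _; rewrite mul1r add0r.
Qed.

Lemma lmulDl : left_distributive lmul +%R.
Proof.
move=> g1 g2 g.
rewrite [X in _ = X + _](lmulw (fsubsetUl _ (msupp g2)) (fsubset_refl _)).
rewrite [X in _ = _ + X](lmulw (fsubsetUr (msupp g1) _) (fsubset_refl _)).
rewrite (lmulw (msuppD_le _ _) (fsubset_refl _)).
rewrite -big_split /=; apply/eq_bigr=> k1 _.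
rewrite -big_split /=; apply/eq_bigr=> k2 _.
by rewrite mcoeffD mulrDl monalgUD.
Qed.

Lemma lmulDr : right_distributive lmul +%R.
Proof. by move=> g g1 g2; rewrite !(lmulC g) lmulDl. Qed.

Lemma lmul_suml (I : Type) (r : seq I) (F : I -> L) g :
  lmul (\sum_(i <- r) F i) g = \sum_(i <- r) lmul (F i) g.
Proof. exact: (big_morph (lmul^~ g) (fun _ _ => lmulDl _ _ _) (lmul0 g)). Qed.

Lemma lmul_sumr (I : Type) (r : seq I) (F : I -> L) g :
  lmul g (\sum_(i <- r) F i) = \sum_(i <- r) lmul g (F i).
Proof. exact: (big_morph (lmul g) (fun _ _ => lmulDr _ _ _) (lmulr0 g)). Qed.

Lemma lmulE g1 g2 :
  lmul g1 g2 = \sum_(k <- msupp g1) lmul (U (mcoeff k g1) k) g2.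
Proof. by rewrite {1}(monalgE g1) lmul_suml. Qed.

Lemma lmulA : associative lmul.
Proof.
move=> g1 g2 g3.
rewrite [LHS]lmulE [X in _ = lmul X _]lmulE [RHS]lmul_suml.
apply: eq_bigr => k1 _; rewrite [X in lmul _ X]lmulE [LHS]lmul_sumr.
rewrite [X in _ = lmul X _]lmulC [X in _ = lmul X _]lmulE [RHS]lmul_suml.
apply: eq_bigr => k2 _; rewrite [X in _ = lmul X _]lmulC.
rewrite [X in _ = X]lmulC [RHS]lmulE [X in lmul _ X]lmulC.
rewrite [X in lmul _ X]lmulE [LHS]lmul_sumr; apply: eq_bigr => k3 _.
rewrite [X in _ = X]lmulC [X in lmul _ X]lmulC.
by rewrite !lmulUU mulrA addrA.
Qed.

Lemma lone_neq0 : lone != 0.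
Proof. by apply/eqP/malgP=> /(_ 0) /eqP; rewrite mcoeff0 mcoeffUU oner_eq0. Qed.

HB.instance Definition _ := GRing.Zmodule_isComNzRing.Build L
  lmulA lmulC lmul1 lmulDl lone_neq0.

Lemma lscaleAl (c : R) (g1 g2 : L) : c *: (g1 * g2) = (c *: g1) * g2.
Proof.
have E h : c *: h = U c 0 * h.
  rewrite [RHS]lmulU [LHS]malgZ_def /fgscale.
  by apply: eq_bigr => k _; rewrite add0r.
by rewrite !E mulrA.
Qed.

HB.instance Definition _ := GRing.Lmodule_isLalgebra.Build R L lscaleAl.
HB.instance Definition _ := GRing.Lalgebra_isComAlgebra.Build R L.

End LaurentRing.

HB.lock Definition lmonom (R : comNzRingType) (n : nat) (m : exponent n) :
    laurent R n := mkmalgU m 1.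

Section Monomials.
Context (R : comNzRingType) (n : nat).
Local Notation L := (laurent R n).

(* X_k ^ e, for an integer e of either sign *)
Definition lvarX (k : 'I_n) (e : int) : L :=
  lmonom R [ffun l => if l == k then e else 0].

Definition lvar (k : 'I_n) : L := lvarX k 1.

Lemma lmonomD (m1 m2 : exponent n) : lmonom R (m1 + m2) = lmonom R m1 * lmonom R m2.
Proof. by rewrite lmonom.unlock [RHS]lmulUU mulr1. Qed.

Lemma lmonom0 : lmonom R 0 = 1 :> L.
Proof. by rewrite lmonom.unlock. Qed.

Lemma lvarX0 k : lvarX k 0 = 1.
Proof.
rewrite -lmonom0; congr lmonom; apply/ffunP => l; rewrite !ffunE.
by case: ifP.
Qed.

Lemma lvarXD k e1 e2 : lvarX k (e1 + e2) = lvarX k e1 * lvarX k e2.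
Proof.
rewrite -lmonomD; congr lmonom; apply/ffunP => l; rewrite !ffunE.
by case: ifP; rewrite ?addr0.
Qed.

Lemma lvarXn k (d : nat) : lvarX k d%:Z = lvar k ^+ d.
Proof.
elim: d => [|d IHd]; first exact: lvarX0.
by rewrite exprS -IHd -lvarXD -PoszD add1n.
Qed.

Lemma lmonom_prod (m : exponent n) : lmonom R m = \prod_k lvarX k (m k).
Proof.
rewrite -(big_morph _ lmonomD lmonom0); congr lmonom; apply/ffunP => l.
rewrite sum_ffunE (bigD1 l) //= ffunE eqxx big1 ?addr0 // => k ne.
by rewrite ffunE eq_sym (negPf ne).
Qed.

End Monomials.

(* D is the formal derivative of the grammar with productions X_k -> G k *)
Record formal_derivative (R : comNzRingType) (n : nat)
    (G : 'I_n -> laurent R n) (D : laurent R n -> laurent R n) : Prop :=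
  FormalDerivative {
    fderD : forall u v, D (u + v) = D u + D v;
    fderZ : forall (c : R) u, D (c *: u) = c *: D u;
    fderM : forall u v, D (u * v) = u * D v + v * D u;
    fderC : forall c : R, D c%:A = 0;
    fder_var : forall k, D (lvar R k) = G k
  }.

Local Lemma leibniz_term (R : comNzRingType) (A : comAlgType R) (c d : R)
    (a b e g : A) :
  (c + d) *: (e * (a * b) * g) = a * (d *: (e * b * g)) + b * (c *: (e * a * g)).
Proof.
rewrite -!scalerAr scalerDl addrC; congr (_ *: _ + _ *: _).
  by rewrite mulrCA !mulrA.
by rewrite (mulrC a) mulrCA !mulrA.
Qed.

Local Lemma leibnizZ (R : comNzRingType) (A : comAlgType R) (c : R)
    (u v u' v' : A) :
  (c *: u) * v' + v * (c *: u') = c *: (u * v' + v * u').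
Proof. by rewrite -scalerAl -scalerAr scalerDr. Qed.

Section FormalDerivativeWellDefined.
Context (R : comNzRingType) (n : nat) (G : 'I_n -> laurent R n).
Local Notation L := (laurent R n).

Lemma laurentE (g : L) : g = \sum_(k <- msupp g) mcoeff k g *: lmonom R k.
Proof.
rewrite {1}(monalgE g); apply: eq_bigr => k _.
by apply/malgP => l; rewrite lmonom.unlock mcoeffZ !mcoeffU mulrnAr mulr1.
Qed.

Local Definition dmon (m : exponent n) : L :=
  \sum_i (m i)%:~R *: (lvarX R i (-1) * lmonom R m * G i).

Local Definition der (g : L) : L := \sum_(k <- msupp g) mcoeff k g *: dmon k.

Local Lemma derw (d : {fset exponent n}) (g : L) : msupp g `<=` d ->
  der g = \sum_(k <- d) mcoeff k g *: dmon k.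
Proof.
by move=> le; apply: big_fset_incl => // k _ /mcoeff_outdom ->; rewrite scale0r.
Qed.

Local Lemma derD u v : der (u + v) = der u + der v.
Proof.
rewrite (derw (msuppD_le u v)) (derw (fsubsetUl (msupp u) (msupp v))).
rewrite (derw (fsubsetUr (msupp u) (msupp v))) -big_split /=.
by apply: eq_bigr => k _; rewrite mcoeffD scalerDl.
Qed.

Local Lemma derZ c u : der (c *: u) = c *: der u.
Proof.
rewrite (derw (msuppZ_le c u)) scaler_sumr; apply: eq_bigr => k _.
by rewrite mcoeffZ scalerA.
Qed.

Local Lemma der0 : der 0 = 0.
Proof. by rewrite /der msupp0 big_seq_fset0. Qed.

Local Lemma der_sum (I : Type) (r : seq I) (F : I -> L) :
  der (\sum_(i <- r) F i) = \sum_(i <- r) der (F i).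
Proof. exact: (big_morph der derD der0). Qed.

Local Lemma derE m : der (lmonom R m) = dmon m.
Proof. by rewrite /der lmonom.unlock msuppU oner_eq0 big_seq_fset1 mcoeffUU scale1r. Qed.

Local Lemma dmonD m1 m2 :
  dmon (m1 + m2) = lmonom R m1 * dmon m2 + lmonom R m2 * dmon m1.
Proof.
rewrite /dmon !mulr_sumr -big_split /=; apply: eq_bigr => i _.
rewrite !ffunE intrD lmonomD; exact: leibniz_term.
Qed.

Local Lemma derM u v : der (u * v) = u * der v + v * der u.
Proof.
rewrite (laurentE u) mulr_suml !der_sum mulr_suml mulr_sumr -big_split /=.
apply: eq_bigr => k _; rewrite -scalerAl !derZ leibnizZ; congr (_ *: _).
rewrite (laurentE v) mulr_sumr !der_sum mulr_suml mulr_sumr -big_split /=.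
apply: eq_bigr => l _; rewrite -scalerAr !derZ [RHS]addrC leibnizZ !derE.
by rewrite -lmonomD derE dmonD addrC.
Qed.

Local Lemma der_var k : der (lvar R k) = G k.
Proof.
rewrite derE /dmon (bigD1 k) //= big1 ?addr0 => [|i ne].
  by rewrite ffunE eqxx scale1r -lvarXD addNr lvarX0 mul1r.
by rewrite ffunE (negPf ne) scale0r.
Qed.

Local Lemma der1 : der 1 = 0.
Proof.
have /eqP := derM 1 1; rewrite !mul1r -subr_eq0 opprD addNKr oppr_eq0.
by move/eqP.
Qed.

Lemma formal_derivative_exists : exists D, formal_derivative G D.
Proof.
exists der; constructor; [exact: derD|exact: derZ|exact: derM| |exact: der_var].
by move=> c; rewrite derZ der1 scaler0.
Qed.

Lemma formal_derivative_unique D1 D2 :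
  formal_derivative G D1 -> formal_derivative G D2 -> D1 =1 D2.
Proof.
case=> aD1 zD1 mD1 cD1 vD1 [aD2 zD2 mD2 cD2 vD2].
have one1 : D1 1 = 0 by rewrite -(cD1 1) scale1r.
have one2 : D2 1 = 0 by rewrite -(cD2 1) scale1r.
have agreeM u v : D1 u = D2 u -> D1 v = D2 v -> D1 (u * v) = D2 (u * v).
  by move=> eu ev; rewrite mD1 mD2 eu ev.
have agreeV u v : u * v = 1 -> D1 u = D2 u -> D1 v = D2 v.
  move=> uv1 eu; have := mD1 u v; have := mD2 u v.
  rewrite uv1 one1 one2 eu => -> /addIr /(congr1 ( *%R v)).
  by rewrite !mulrA (mulrC v) uv1 !mul1r.
have agreeX k (d : nat) : D1 (lvarX R k d) = D2 (lvarX R k d).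
  rewrite lvarXn; elim: d => [|d IHd]; first by rewrite expr0 one1 one2.
  by rewrite exprS agreeM // vD1 vD2.
have agree_lvarX k e : D1 (lvarX R k e) = D2 (lvarX R k e).
  case: (intP e) => [|d|d]; [exact: agreeX|exact: agreeX|].
  by apply: (agreeV (lvarX R k d.+1)); rewrite // -lvarXD subrr lvarX0.
move=> g; rewrite (laurentE g); apply: (big_ind (fun u => D1 u = D2 u)).
- by rewrite -(scale0r 1) cD1 cD2.
- by move=> u v eu ev; rewrite aD1 aD2 eu ev.
move=> m _; rewrite zD1 zD2 lmonom_prod; congr (_ *: _).
apply: (big_ind (fun u => D1 u = D2 u)) => [|u v|k _]; last exact: agree_lvarX.
  by rewrite one1 one2.
exact: agreeM.
Qed.

End FormalDerivativeWellDefined.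

(* The word 0 = p_0, p_1, ..., p_n, p_(n+1) = 0 of a permutation of [n], whose
   k-th letter, for 1 <= k <= n, is 1 + p (k - 1) since 'S_n acts on
   {0, ..., n - 1}. *)
Definition pword (n : nat) (p : 'S_n) (k : nat) : nat :=
  if k is k'.+1 then oapp (fun i : 'I_n => (p i).+1) 0%N (insub k') else 0%N.

Definition is_peak (n : nat) (p : 'S_n) (k : nat) : bool :=
  (pword p k.-1 < pword p k)%N && (pword p k > pword p k.+1)%N.

Definition is_double_descent (n : nat) (p : 'S_n) (k : nat) : bool :=
  (pword p k.-1 > pword p k)%N && (pword p k > pword p k.+1)%N.

Definition npeaks (n : nat) (p : 'S_n) : nat :=
  count (is_peak p) (iota 1 n).

Definition ndouble_descents (n : nat) (p : 'S_n) : nat :=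
  count (is_double_descent p) (iota 1 n).

Definition Qnum (n i j : nat) : nat :=
  #|[set p : 'S_n | (npeaks p == i) && (ndouble_descents p == j)]|.

Section Grammar.
Context (R : comNzRingType).

Definition ix : 'I_4 := @Ordinal 4 0 isT.
Definition iy : 'I_4 := @Ordinal 4 1 isT.
Definition iz : 'I_4 := @Ordinal 4 2 isT.
Definition iw : 'I_4 := @Ordinal 4 3 isT.

Local Notation x := (lvar R ix).
Local Notation y := (lvar R iy).
Local Notation z := (lvar R iz).
Local Notation w := (lvar R iw).

Definition grammarG (k : 'I_4) : laurent R 4 :=
  tnth [tuple x * y; x * z; z * w; x * z] k.

(* A permutation of [n] has at most n peaks and at most n double descents, so
   the bounds on i and j drop only zero terms. *)
Definition Qpoly (n : nat) : laurent R 4 :=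
  \sum_(i < n.+1) \sum_(j < n.+1)
    (Qnum n i j)%:R *: (lvarX R ix i * lvarX R iy j * lvarX R iz i *
                        lvarX R iw ((n.+1)%:Z - (2 * i)%:Z - j%:Z)).

End Grammar.

(* Main.v *)
(** Give each letter of the word 0, p_1, ..., p_n, 0 the label xz if it is a
    peak, y if it is a double descent, w if it is a double ascent, and 1 if it
    is a valley; the two zeros count as valleys. The grammar splits as
    D(label) = (contribution of the ascent entering the letter)
             + (contribution of the descent leaving it),
    so that D of the product of the labels is a sum over the n + 1 gaps of the
    word, and the term of a gap is the weight of the permutation of [n + 1]
    obtained by inserting n + 1 there. *)
Require Import Defs.
From HB Require Import structures.
From mathcomp Require Import all_boot all_order all_algebra all_fingroup.
From mathcomp Require Import zify.

Set Implicit Arguments.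
Unset Strict Implicit.
Unset Printing Implicit Defensive.

Import Order.TTheory GRing.Theory Num.Theory.

Local Open Scope ring_scope.

(** * Labels and weights of words *)

Local Notation x := (lvar _ ix).
Local Notation y := (lvar _ iy).
Local Notation z := (lvar _ iz).
Local Notation w := (lvar _ iw).

(* As [0.-1 = 0], position [0] has no ascent into it, so it counts as a valley. *)
Definition asc_into (f : nat -> nat) (k : nat) : bool := (f k.-1 < f k)%N.
Definition desc_from (f : nat -> nat) (k : nat) : bool := (f k.+1 < f k)%N.

Definition insert_after (f : nat -> nat) (k N m : nat) : nat :=
  if (m <= k)%N then f m else if m == k.+1 then N else f m.-1.

Definition label (R : comNzRingType) (f : nat -> nat) (k : nat) : laurent R 4 :=
  if asc_into f k then (if desc_from f k then x * z else w)
  else (if desc_from f k then y else 1).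

Definition weight (R : comNzRingType) (n : nat) (f : nat -> nat) : laurent R 4 :=
  \prod_(0 <= k < n.+2) label R f k.

(** Each gap [k] from [0] to [n], lying between positions [k] and [k.+1], is then a strict ascent or
    a strict descent, and no descent leaves the final zero. *)
Definition gapped (n : nat) (f : nat -> nat) : Prop :=
  f n.+1 = 0%N /\ forall k, (k <= n)%N -> f k != f k.+1.

Lemma eq_weight (R : comNzRingType) (n : nat) (f g : nat -> nat) :
  f =1 g -> weight R n f = weight R n g.
Proof.
by move=> fg; apply: eq_bigr => k _; rewrite /label /asc_into /desc_from !fg.
Qed.

(** * The derivative of a weight as a sum over gaps *)

Lemma leibniz_prod (A : comPzRingType) (D : A -> A) (D1 : D 1 = 0)
    (DM : forall u v, D (u * v) = u * D v + v * D u) (F : nat -> A) (n : nat) :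
  D (\prod_(0 <= k < n) F k) =
  \sum_(0 <= k < n)
    (\prod_(0 <= j < k) F j) * D (F k) * \prod_(k.+1 <= j < n) F j.
Proof.
elim: n => [|n IHn]; first by rewrite !big_nil.
rewrite big_nat_recr //= DM IHn [RHS]big_nat_recr //= (big_geq (leqnn n.+1)).
rewrite mulr1 addrC; congr (_ + _); rewrite mulr_sumr.
apply: eq_big_nat => k /andP[_ kn].
by rewrite (big_nat_recr _ _ _ kn) /= mulrC !mulrA.
Qed.

(** Regrouping by gaps: gap [k] is either the ascent into [k.+1] or the descent from [k], never
    both. Position [0] has no ascent and [n.+1] no descent. *)
Lemma sum_asc_desc (V : nmodType) (n : nat) (f : nat -> nat) (A B : nat -> V) :
  gapped n f ->
  \sum_(0 <= k < n.+2) ((if asc_into f k then A k else 0) +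
                        (if desc_from f k then B k else 0)) =
  \sum_(0 <= k < n.+1) (if (f k < f k.+1)%N then A k.+1 else B k).
Proof.
move=> [fn fadj]; rewrite big_split /=.
rewrite [X in X + _]big_nat_recl // [X in _ + X]big_nat_recr //=.
rewrite {1}/asc_into {2}/desc_from fn ltnn ltn0 add0r addr0 -big_split /=.
apply: eq_big_nat => k /andP[_ kn].
rewrite /asc_into /desc_from /=.
by case: ltngtP (fadj k kn); rewrite ?addr0 ?add0r.
Qed.

(** The first summand reads as inserting a larger letter just before position [k]: that letter is a
    peak [x * z], and letter [k], deprived of its ascent, is relabelled [y] or [1]. The second is
    insertion just after [k], which loses its descent. *)
Lemma fder_label (R : comNzRingType) (D : laurent R 4 -> laurent R 4)
    (hD : formal_derivative (grammarG R) D) (f : nat -> nat) (k : nat) :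
  D (label R f k) =
    (if asc_into f k then x * z * (if desc_from f k then y else 1) else 0) +
    (if desc_from f k then x * z * (if asc_into f k then w else 1) else 0).
Proof.
rewrite /label; case: ifP => _; case: ifP => _; rewrite ?mulr1 ?addr0 ?add0r.
- rewrite (fderM hD) !(fder_var hD) /grammarG !(tnth_nth 0) /=.
  by rewrite addrC !mulrA (mulrC (lvar R iz)).
- by rewrite (fder_var hD) /grammarG (tnth_nth 0).
- by rewrite (fder_var hD) /grammarG (tnth_nth 0).
by rewrite -(fderC hD 1) scale1r.
Qed.

(** As [N] exceeds all letters, it is a peak, its left neighbour has no descent and its right
    neighbour no ascent; all other labels are kept. *)
Lemma weight_insert (R : comNzRingType) (n : nat) (f : nat -> nat) (k N : nat) :
  (k <= n)%N -> (forall m, f m < N)%N ->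
  weight R n.+1 (insert_after f k N) =
  (\prod_(0 <= j < k) label R f j) *
  ((if asc_into f k then w else 1) * (x * z) *
   (if desc_from f k.+1 then y else 1)) *
  \prod_(k.+2 <= j < n.+2) label R f j.
Proof.
move=> kn fN; rewrite /weight.
rewrite (@big_cat_nat _ _ _ k) //=; last by lia.
rewrite -mulrA; congr (_ * _).
  apply: eq_big_nat => j /andP[_ jk].
  rewrite /label /asc_into /desc_from /insert_after.
  have -> : (j.-1 <= k)%N by lia.
  by rewrite (ltnW jk) jk.
rewrite big_ltn; last by lia.
rewrite big_ltn; last by lia.
rewrite big_ltn; last by lia.
have -> : label R (insert_after f k N) k = if asc_into f k then w else 1.
  rewrite /label /asc_into /desc_from /insert_after leq_pred leqnn ltnn eqxx.
  by have -> : (N < f k)%N = false by apply/negbTE; rewrite -leqNgt ltnW.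
have -> : label R (insert_after f k N) k.+1 = x * z.
  rewrite /label /asc_into /desc_from /insert_after /= leqnn ltnn eqxx fN.
  have -> : (k.+1 < k)%N = false by lia.
  have -> : (k.+2 == k.+1) = false by lia.
  by rewrite fN.
have -> : label R (insert_after f k N) k.+2 =
          if desc_from f k.+1 then y else 1.
  rewrite /label /asc_into /desc_from /insert_after /= ltnn eqxx.
  have -> : (k.+1 < k)%N = false by lia.
  have -> : (k.+2 < k)%N = false by lia.
  have -> : (k.+2 == k.+1) = false by lia.
  have -> : (k.+3 == k.+1) = false by lia.
  by have -> : (N < f k.+1)%N = false by apply/negbTE; rewrite -leqNgt ltnW.
rewrite !mulrA; congr (_ * _).
rewrite big_add1 /=; apply: eq_big_nat => j /andP[kj _].
rewrite /label /asc_into /desc_from /insert_after /=.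
have -> : (j.+1 <= k)%N = false by lia.
have -> : (j <= k)%N = false by lia.
have -> : (j.+2 <= k)%N = false by lia.
have -> : (j.+1 == k.+1) = false by lia.
have -> : (j.+2 == k.+1) = false by lia.
by have -> : (j == k.+1) = false by lia.
Qed.

Lemma fder_weight (R : comNzRingType) (D : laurent R 4 -> laurent R 4)
    (hD : formal_derivative (grammarG R) D) (n : nat) (f : nat -> nat) (N : nat) :
  gapped n f -> (forall m, f m < N)%N ->
  D (weight R n f) = \sum_(0 <= k < n.+1) weight R n.+1 (insert_after f k N).
Proof.
move=> fgap fN; have D1 : D 1 = 0 by rewrite -(fderC hD 1) scale1r.
have mul_if (b : bool) (u v t : laurent R 4) :
    u * (if b then v else 0) * t = if b then u * v * t else 0.
  by case: b; rewrite // mulr0 mul0r.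
rewrite {1}/weight (leibniz_prod D1 (fderM hD)).
under eq_bigr do rewrite (fder_label hD) mulrDr mulrDl !mul_if.
rewrite sum_asc_desc //; apply: eq_big_nat => k /andP[_ kn].
rewrite weight_insert //.
(* In an ascent gap, position [k] has no descent, so its label is already the [w] or [1] of the
   insertion. *)
have [fk|] := ltnP.
  rewrite [in LHS](@big_nat_recr _ _ _ k) //= -!mulrA; congr (_ * _).
  by rewrite {1}/label /desc_from [(f k.+1 < f k)%N]ltnNge (ltnW fk).
(* In a descent gap, the label at [k.+1] is likewise already [y] or [1]. *)
rewrite leq_eqVlt eq_sym (negPf (fgap.2 _ _)) //= => fk.
rewrite [in LHS](@big_ltn _ _ _ k.+1) //=.
rewrite !mulrA; congr (_ * _); rewrite -!mulrA; congr (_ * _).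
rewrite /label /asc_into /desc_from /= [(f k < f k.+1)%N]ltnNge (ltnW fk) /=.
by rewrite [RHS]mulrC !mulrA [RHS]mulrAC.
Qed.

(** * Words of permutations and insertion of the largest letter *)

#[local] Arguments pword : simpl never.

Lemma pword_out (n : nat) (p : 'S_n) (m : nat) : (n < m)%N -> pword p m = 0%N.
Proof. by case: m => // m nm; rewrite /pword insubN // -leqNgt. Qed.

Lemma pwordE (n : nat) (p : 'S_n) (i : 'I_n) : pword p i.+1 = (p i).+1.
Proof. by rewrite /pword valK. Qed.

Lemma pword_lt (n : nat) (p : 'S_n) (m : nat) : (pword p m < n.+1)%N.
Proof.
by case: m => //= m; rewrite /pword; case: insubP => //= i _ _; rewrite ltnS.
Qed.

(** The letters are distinct and positive, and with [0 < n] the two zeros are not adjacent. *)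
Lemma gapped_pword (n : nat) (p : 'S_n) : (0 < n)%N -> gapped n (pword p).
Proof.
move=> n0; split=> [|k]; first exact: pword_out.
case: (posnP k) => [-> _|k0]; first by rewrite (pwordE p (Ordinal n0)).
case: k k0 => // k _ kn; rewrite (pwordE p (Ordinal kn)).
have [kn'|kn'] := ltnP k.+1 n; last by rewrite pword_out.
rewrite (pwordE p (Ordinal kn')) eqSS.
by apply/eqP => /val_inj/perm_inj/(congr1 val) /=; lia.
Qed.

(** Permutation indices start at 0 and letters at position 1, so the maximum placed at index [k]
    becomes the letter [n.+1] at position [k.+1]. *)
Lemma pword_lift_perm (n : nat) (p : 'S_n) (k : 'I_n.+1) :
  pword (lift_perm k ord_max p) =1 insert_after (pword p) k n.+1.
Proof.
case=> [|m]; rewrite /insert_after // succnK.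
have kn := ltn_ord k.
have [mn|nm] := ltnP m n.+1; last first.
  rewrite !pword_out //; try lia.
  have -> : (m < k)%N = false by lia.
  by have -> : (m.+1 == k.+1) = false by lia.
rewrite (pwordE _ (Ordinal mn)).
case: (unliftP k (Ordinal mn)) => [j|] jE; last first.
  by rewrite jE lift_perm_id -[in RHS](congr1 val jE) /= ltnn eqxx.
have mE := congr1 val jE.
rewrite jE lift_perm_lift lift_max; rewrite /= /bump in mE.
case: (leqP k j) mE => kj ->; rewrite ?add0n ?add1n.
  have -> : (j.+1 < k)%N = false by lia.
  have -> : (j.+2 == k.+1) = false by lia.
  by rewrite pwordE.
by rewrite kj pwordE.
Qed.

(** A permutation is determined by the preimage [k] of [i0] and by what remains after its removal;
    injectivity and the count (n+1)! = (n+1) n! give a bijection. *)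
Lemma sum_lift_perm (V : nmodType) (n : nat) (i0 : 'I_n.+1) (F : 'S_n.+1 -> V) :
  \sum_(s : 'S_n.+1) F s =
  \sum_(p : 'S_n) \sum_(k < n.+1) F (lift_perm k i0 p).
Proof.
pose g (q : 'S_n * 'I_n.+1) := lift_perm q.2 i0 q.1.
have g_inj : injective g.
  move=> [p k] [p' k'] /= gE.
  have kE : k = k'.
    apply: (@perm_inj _ (g (p, k))).
    by rewrite {2}gE /g /= !lift_perm_id.
  rewrite -{}kE in gE *; congr (_, _); apply/permP => i.
  have /permP/(_ (lift k i)) := gE.
  by rewrite /g /= !lift_perm_lift => /lift_inj.
have g_bij : bijective g.
  apply: inj_card_bij => //.
  by rewrite card_prod !card_Sn card_ord factS mulnC.
by rewrite pair_big (reindex g) //; apply: onW_bij.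
Qed.

Lemma iter_fder_weight (R : comNzRingType) (D : laurent R 4 -> laurent R 4)
    (hD : formal_derivative (grammarG R) D) (n : nat) :
  (0 < n)%N -> iter n D (lvar R iy) = \sum_(p : 'S_n) weight R n (pword p).
Proof.
case: n => // n _; elim: n => [|n IHn].
  (* The induction starts at the word 0, 1, 0, whose labels [1], [x * z], [1] multiply to D(y). *)
  rewrite /= (fder_var hD) /grammarG (tnth_nth 0) /=.
  rewrite (big_pred1 (1%g : 'S_1)) => [|p]; last by rewrite (permS1 p) /= eqxx.
  rewrite /weight !big_nat_recr //= big_nil.
  rewrite /label /asc_into /desc_from (pwordE 1 ord0) permE /= pword_out //=.
  by rewrite !mul1r mulr1.
have D0 : D 0 = 0 by have := fderC hD 0; rewrite scale0r.
rewrite iterS IHn (big_morph D (fderD hD) D0).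
rewrite [RHS](sum_lift_perm ord_max); apply: eq_bigr => p _.
rewrite (fder_weight hD (gapped_pword p _) (pword_lt p)) // big_mkord.
by apply: eq_bigr => k _; apply/esym/eq_weight/pword_lift_perm.
Qed.

(** * From weights to peaks and double descents *)

Lemma weight_counts (R : comNzRingType) (n : nat) (f : nat -> nat) :
  gapped n f -> f 0 = 0%N ->
  let i := count (fun k => asc_into f k && desc_from f k) (iota 1 n) in
  let j := count (fun k => ~~ asc_into f k && desc_from f k) (iota 1 n) in
  weight R n f = lvarX R ix i * lvarX R iy j * lvarX R iz i *
    lvarX R iw ((n.+1)%:Z - (2 * i)%:Z - j%:Z).
Proof.
move=> fgap f0 i j.
pose l := count (fun k => asc_into f k && ~~ desc_from f k) (iota 1 n).
have [a0 d0] : asc_into f 0 = false /\ desc_from f 0 = false.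
  by rewrite /asc_into /desc_from f0.
have [aS dS] : asc_into f n.+1 = false /\ desc_from f n.+1 = false.
  by rewrite /asc_into /desc_from fgap.1.
(* The exponent of [w] is the number of double ascents: when [sum_asc_desc] counts the [n.+1] gaps,
   a peak accounts for two, a double ascent or double descent for one, a valley for none. *)
have lE : (n.+1)%:Z - (2 * i)%:Z - j%:Z = l%:Z.
  suff : (2 * i + j + l = n.+1)%N by lia.
  have := @sum_asc_desc nat n f (fun=> 1%N) (fun=> 1%N) fgap.
  under [in RHS]eq_bigr do rewrite if_same.
  rewrite sum_nat_const_nat muln1 subn0 => <-.
  rewrite big_ltn // big_nat_recr //= a0 d0 aS dS add0r !addr0.
  rewrite /index_iota subn1 /= /i /j /l.
  elim: (iota 1 n) => [|k s IHs]; first by rewrite big_nil.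
  rewrite big_cons -IHs /=.
  by case: asc_into; case: desc_from => /=; lia.
have wE : weight R n f = (x * z) ^+ i * y ^+ j * w ^+ l.
  rewrite /weight big_ltn // big_nat_recr //= /label a0 d0 aS dS mul1r mulr1.
  rewrite /index_iota subn1 /=.
  rewrite {}/i {}/j {}/l in lE *; elim: (iota 1 n) => [|k s IHs].
    by rewrite big_nil !mulr1.
  rewrite big_cons IHs /=.
  case: asc_into; case: desc_from => /=; rewrite ?add0n ?add1n ?exprS.
  - by rewrite !mulrA.
  - by rewrite mulrCA.
  - by rewrite -!mulrA mulrCA.
  - by rewrite mul1r.
rewrite wE lE !lvarXn exprMn; congr (_ * _).
by rewrite mulrAC.
Qed.

Lemma npeaks_le (n : nat) (p : 'S_n) : (npeaks p <= n)%N.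
Proof. by rewrite -[leqRHS](size_iota 1) count_size. Qed.

Lemma ndouble_descents_le (n : nat) (p : 'S_n) : (ndouble_descents p <= n)%N.
Proof. by rewrite -[leqRHS](size_iota 1) count_size. Qed.

Lemma QpolyE (R : comNzRingType) (n : nat) :
  Qpoly R n = \sum_(p : 'S_n)
    lvarX R ix (npeaks p) * lvarX R iy (ndouble_descents p) *
    lvarX R iz (npeaks p) *
    lvarX R iw ((n.+1)%:Z - (2 * npeaks p)%:Z - (ndouble_descents p)%:Z).
Proof.
(* Both counts are at most [n], so [inord] loses nothing and the fibres of [c] have the sizes
   [Qnum n i j]. *)
pose c (p : 'S_n) : 'I_n.+1 * 'I_n.+1 :=
  (inord (npeaks p), inord (ndouble_descents p)).
rewrite /Qpoly pair_big (partition_big c predT) //=.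
apply: eq_bigr => -[i j] _ /=.
have cE p : (c p == (i, j)) = (npeaks p == i) && (ndouble_descents p == j).
  by rewrite xpair_eqE -!val_eqE /= !inordK // ltnS
    ?npeaks_le ?ndouble_descents_le.
rewrite [RHS](eq_bigr (fun=> lvarX R ix i * lvarX R iy j * lvarX R iz i *
  lvarX R iw ((n.+1)%:Z - (2 * i)%:Z - j%:Z))); last first.
  by move=> p; rewrite cE => /andP[/eqP-> /eqP->].
rewrite sumr_const scaler_nat; congr (_ *+ _).
by rewrite /Qnum -sum1dep_card -sum1_card; apply: eq_bigl => p; rewrite -cE.
Qed.

Theorem theorem2p2 (R : comNzRingType) (D : laurent R 4 -> laurent R 4)
    (hD : formal_derivative (grammarG R) D) (n : nat) (hn : (1 <= n)%N) :
  iter n D (lvar R iy) = Qpoly R n.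
Proof.
rewrite (iter_fder_weight hD) // QpolyE; apply: eq_bigr => p _.
rewrite (weight_counts R (gapped_pword p hn)) //.
(* A double descent asks for a strict descent into the letter, the count below only for the absence
   of an ascent; these agree because neighbouring letters differ. *)
have -> : ndouble_descents p =
    count (fun k => ~~ asc_into (pword p) k && desc_from (pword p) k) (iota 1 n).
  apply: eq_in_count => -[|k]; rewrite mem_iota // => /andP[_ kn].
  rewrite /is_double_descent /asc_into /desc_from -leqNgt [in RHS]leq_eqVlt.
  rewrite [_ == pword p _.+1.-1]eq_sym.
  by rewrite (negPf ((gapped_pword p hn).2 _ _)) // ltnW.
by [].
Qed.
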